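(* Let $G$ and $H$ be finite simple connected graphs with $|V(G)|>1$, and let $L$ be a non-empty proper subset of $V(G)$. Suppose that $J_{G\circ_L H}$ is unmixed. Then: (1) $L$ contains no cut vertex of $G$. More generally, for every subset $L_0\subseteq L$ we have $L_0\in \mathscr{C}(G\circ_L H)$, while the induced subgraph $G\setminus L_0$ of $G$ is connected. In particular, $G\setminus L$ is connected. (2) $J_H$ is unmixed.
   Context: All graphs are finite, simple and (unless stated otherwise) connected. For a graph $\Gamma$ on vertex set $V(\Gamma)$ and a field $\mathbf{k}$, the binomial edge ideal is $J_\Gamma=\langle x_iy_j-x_jy_i : \{i,j\}\in E(\Gamma), i<j\rangle\subseteq \mathbf{k}[x_u,y_u : u\in V(\Gamma)]$; $\Gamma$ (or $J_\Gamma$) is unmixed if all associated primes of $J_\Gamma$ have the same height. For $A\subseteq V(\Gamma)$, $\Gamma\setminus A$ is the induced subgraph on $V(\Gamma)\setminus A$, and $\omega(\Gamma\setminus A)$ is its number of connected components. A subset $T\subseteq V(\Gamma)$ is a cutset if $T=\emptyset$ or, for every $v\in T$, $\omega(\Gamma\setminus (T\setminus\{v\}))<\omega(\Gamma\setminus T)$; $\mathscr{C}(\Gamma)$ denotes the set of cutsets. A cut vertex of $G$ is a vertex whose removal increases the number of connected components. For a non-empty $L\subseteq V(G)$, the $L$-corona product $G\circ_L H$ is the graph obtained from $G$ by taking, for each $v\in L$, a disjoint copy $H_v$ of $H$ and joining $v$ by an edge to every vertex of $H_v$. *)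

(* Defs.v *)
From HB Require Import structures.
From mathcomp Require Import all_boot all_order all_algebra.
From mathcomp Require Import mpoly.
Set Implicit Arguments. Unset Strict Implicit. Unset Printing Implicit Defensive.
Import Order.TTheory GRing.Theory.
Local Open Scope ring_scope.

Definition simple_graph (T : finType) (e : rel T) : Prop :=
  ssrbool.symmetric e /\ ssrbool.irreflexive e.

Definition restrict_rel (T : finType) (e : rel T) (S : {set T}) : rel T :=
  fun x y => [&& x \in S, y \in S & e x y].

Definition ncomp (T : finType) (e : rel T) (S : {set T}) : nat :=
  #|[set [set y in S | connect (restrict_rel e S) x y] | x in S]|.

Definition connected_on (T : finType) (e : rel T) (S : {set T}) : Prop :=
  forall x y, x \in S -> y \in S -> connect (restrict_rel e S) x y.

Definition connected_graph (T : finType) (e : rel T) : Prop :=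
  connected_on e [set: T].

Definition omega (T : finType) (e : rel T) (A : {set T}) : nat := ncomp e (~: A).

Definition cut_vertex (T : finType) (e : rel T) (v : T) : Prop :=
  (omega e set0 < omega e [set v])%N.

Definition cutset (T : finType) (e : rel T) (A : {set T}) : Prop :=
  A = set0 \/ forall v, v \in A -> (omega e (A :\ v) < omega e A)%N.

Definition corona_vert (TG TH : finType) (L : {set TG}) : finType :=
  (TG + ({v : TG | v \in L} * TH))%type.

Definition corona_rel (TG TH : finType) (eG : rel TG) (eH : rel TH) (L : {set TG})
  : rel (corona_vert TH L) :=
  fun a b => match a, b with
  | inl u, inl v => eG u v
  | inl u, inr (w, _) => u == val w
  | inr (w, _), inl u => val w == u
  | inr (w, h), inr (w', h') => (w == w') && eH h h'
  end.

Arguments corona_rel {TG TH} eG eH L.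

Section Ideals.
Variable R : comNzRingType.

Definition gen_ideal (S : R -> Prop) : R -> Prop :=
  fun p => exists s : seq (R * R),
    (forall q, q \in s -> S q.2) /\ p = \sum_(q <- s) q.1 * q.2.

Definition is_ideal (I : R -> Prop) : Prop :=
  I 0 /\ (forall a b, I a -> I b -> I (a + b)) /\ (forall r a, I a -> I (r * a)).

Definition is_prime_ideal (P : R -> Prop) : Prop :=
  is_ideal P /\ ~ P 1 /\ (forall a b, P (a * b) -> P a \/ P b).

Definition associated_prime (I P : R -> Prop) : Prop :=
  is_prime_ideal P /\ exists f : R, forall g, P g <-> I (f * g).

Definition strict_incl (A B : R -> Prop) : Prop :=
  (forall x, A x -> B x) /\ exists x, B x /\ ~ A x.

(* there is a chain of primes P_0 < P_1 < ... < P_k = P ; height P = sup of such k *)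
Definition prime_chain_below (P : R -> Prop) (k : nat) : Prop :=
  exists c : nat -> (R -> Prop),
    c k = P /\ (forall i, (i <= k)%N -> is_prime_ideal (c i)) /\
    (forall i, (i < k)%N -> strict_incl (c i) (c i.+1)).

(* unmixed: all associated primes have the same height
   (heights compared as suprema of chain lengths) *)
Definition unmixed (I : R -> Prop) : Prop :=
  forall P Q, associated_prime I P -> associated_prime I Q ->
    forall k, prime_chain_below P k <-> prime_chain_below Q k.
End Ideals.

(* The ring k[x_u, y_u : u in V]: variables x_u = 'X_(u), y_u = 'X_(|V|+u),
   vertices labelled 0..|V|-1 by enum_rank. *)
Definition bei_ring (k : fieldType) (T : finType) := {mpoly k[#|T| + #|T|]}.

Definition xvar (k : fieldType) (T : finType) (u : T) : bei_ring k T :=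
  'X_(lshift #|T| (enum_rank u)).
Definition yvar (k : fieldType) (T : finType) (u : T) : bei_ring k T :=
  'X_(rshift #|T| (enum_rank u)).

Arguments xvar k {T} u.
Arguments yvar k {T} u.

Definition bei_gens (k : fieldType) (T : finType) (e : rel T) : bei_ring k T -> Prop :=
  fun g => exists i j : T, e i j /\ (enum_rank i < enum_rank j)%N /\
    g = xvar k i * yvar k j - xvar k j * yvar k i.

Arguments bei_gens k {T} e.

Definition binomial_edge_ideal (k : fieldType) (T : finType) (e : rel T) :=
  gen_ideal (bei_gens k e).
Arguments binomial_edge_ideal k {T} e.

(* Main.v *)
Require Import Defs.
From mathcomp Require Import all_boot all_order all_algebra.
From mathcomp Require Import mpoly zify ring.
From Stdlib Require Import Classical.
Set Implicit Arguments. Unset Strict Implicit. Unset Printing Implicit Defensive.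
Import Order.TTheory GRing.Theory.
Local Open Scope ring_scope.

(** For a set of vertices A let P_A be the kernel of the toric map which kills
    the variables of A and sends x_i to X_i and y_i to X_i Y_c, where c is the
    component of i in the complement of A.  Modulo J_e, a monomial of fixed
    multidegree is a configuration of particles (the y's) on its support, and a
    generator lets a particle move along an edge; two configurations are
    therefore congruent as soon as they have the same number of particles in each
    component of the support.  Hence J_e is the intersection of all the P_A, and
    its associated primes are the P_A for the sets A each of whose vertices has
    neighbours in two components of the complement of A.

    The chains of primes below P_A have length at most n + |A| - omega(A): an
    explicit chain of specialisations of length 2n runs from 0 to the maximal
    ideal through P_A, and no chain of primes is longer than the number N of
    variables, since a chain of length m yields, for some E and all D, D^m
    linearly independent polynomials of degree at most D E, whereas the space of
    these polynomials has dimension O(D^N).  So J_e is unmixed if and only if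
    omega(A) = |A| + omega(0) for all these A.

    In the corona product, induction on |L0| shows that L0 is a cutset having
    |L0| + omega(G \ L0) components, so that G \ L0 is connected.  For a cutset T
    of H and v in L, the union of v and of the copy of T in H_v is a cutset with
    one component more than H \ T, which transfers unmixedness to H. *)

(** * Components and separating sets *)

Lemma connect_invariant (T : finType) (e : rel T) (U : Type) (lab : T -> U) :
  (forall x y, e x y -> lab x = lab y) ->
  forall x y, connect e x y -> lab x = lab y.
Proof.
move=> lab_e x y /connectP[p]; elim: p x => [|z p IHp] x /= => [_ -> //|].
by case/andP=> /lab_e-> /IHp/[apply].
Qed.

Lemma connect_homo (T T' : finType) (e : rel T) (e' : rel T') (f : T -> T') :
  (forall x y, e x y -> connect e' (f x) (f y)) ->
  forall x y, connect e x y -> connect e' (f x) (f y).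
Proof.
move=> f_e x y /connectP[p]; elim: p x => [|z p IHp] x /=; first by move=> _ ->.
by case/andP=> /f_e exz /IHp/[apply]; apply: connect_trans.
Qed.

(** Vertices of [A] are isolated in the restricted relation, each being its own root; hence
    [comp_reps] keeps only roots outside [A]. *)
Definition comp_root (T : finType) (e : rel T) (A : {set T}) : T -> T :=
  fingraph.root (restrict_rel e (~: A)).

Definition comp_reps (T : finType) (e : rel T) (A : {set T}) : {set T} :=
  [set x in ~: A | comp_root e A x == x].

(* For a simple graph this is [cutset]: putting [v] back lowers the number of
   components exactly when [v] touches two of them. *)
Definition separating (T : finType) (e : rel T) (A : {set T}) : bool :=
  [forall v in A, [exists u1, [exists u2,
    [&& u1 \notin A, u2 \notin A, e v u1, e v u2
      & ~~ connect (restrict_rel e (~: A)) u1 u2]]]].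

Section Components.
Variables (T : finType) (e : rel T).
Hypothesis e_sym : ssrbool.symmetric e.
Implicit Types (A S : {set T}).

Lemma restrict_connect_sym S : connect_sym (restrict_rel e S).
Proof.
by apply: sym_connect_sym => x y; rewrite /restrict_rel e_sym andbCA.
Qed.

Lemma comp_rootP A x y :
  (comp_root e A x == comp_root e A y) = connect (restrict_rel e (~: A)) x y.
Proof. by rewrite root_connect //; apply: restrict_connect_sym. Qed.

Lemma comp_root_edge A x y :
  x \notin A -> y \notin A -> e x y -> comp_root e A x = comp_root e A y.
Proof.
move=> xA yA exy; apply/eqP; rewrite comp_rootP connect1 //.
by rewrite /restrict_rel !inE xA yA.
Qed.

Lemma comp_root_idem A x : comp_root e A (comp_root e A x) = comp_root e A x.
Proof. by apply/fingraph.root_root/restrict_connect_sym. Qed.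

Lemma connect_restrict_mem S x y :
  connect (restrict_rel e S) x y -> (x \in S) = (y \in S).
Proof.
by apply: (@connect_invariant _ _ _ (mem S)) => {x y} x y /and3P[/= -> ->].
Qed.

Lemma comp_root_mem A x : (comp_root e A x \in A) = (x \in A).
Proof.
have := connect_restrict_mem (connect_root (restrict_rel e (~: A)) x).
by rewrite !inE => /negb_inj ->.
Qed.

Lemma comp_root_reps A x : x \notin A -> comp_root e A x \in comp_reps e A.
Proof. by move=> xA; rewrite !inE comp_root_mem xA comp_root_idem eqxx. Qed.

Lemma omega_reps A : omega e A = #|comp_reps e A|.
Proof.
rewrite /omega /ncomp; set cl := fun x => [set y in _ | _].
have cl_root x y : x \in ~: A -> y \in ~: A ->
    (cl x == cl y) = (comp_root e A x == comp_root e A y).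
  move=> xA yA; rewrite comp_rootP; apply/eqP/idP => [/setP/(_ y)|cxy].
    by rewrite !inE connect0 -in_setC yA /= => ->.
  by apply/setP=> z; rewrite !inE (same_connect (@restrict_connect_sym _) cxy).
rewrite -(card_in_imset (f := cl) (D := comp_reps e A)).
  congr #|pred_of_set _|; apply/setP=> B; apply/imsetP/imsetP => -[x xA ->].
    exists (comp_root e A x); first by rewrite comp_root_reps -?in_setC.
    apply/eqP; rewrite cl_root ?comp_root_idem //.
    by rewrite inE comp_root_mem -in_setC.
  by exists x => //; case/setIdP: xA.
move=> x y /setIdP[xA /eqP rx] /setIdP[yA /eqP ry] /eqP.
by rewrite cl_root // rx ry => /eqP.
Qed.

(** Such a label takes a single value on each component. With the next lemma, this computes [omega]
    from explicit labellings. *)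
Lemma leq_label_omega A (U : finType) (lab : T -> U) :
  (forall x y, x \notin A -> y \notin A -> e x y -> lab x = lab y) ->
  (#|lab @: ~: A| <= omega e A)%N.
Proof.
move=> lab_e; rewrite omega_reps.
apply: leq_trans (leq_imset_card lab (comp_reps e A)).
apply/subset_leq_card/subsetP=> _ /imsetP[x xA ->].
have -> : lab x = lab (comp_root e A x).
  have := connect_root (restrict_rel e (~: A)) x.
  apply: connect_invariant => y z /and3P[].
  by rewrite !inE; apply: lab_e.
by apply/imset_f/comp_root_reps; rewrite -in_setC.
Qed.

Lemma leq_omega_label A (U : finType) (lab : T -> U) :
  (forall x y, x \notin A -> y \notin A -> lab x = lab y ->
     connect (restrict_rel e (~: A)) x y) ->
  (omega e A <= #|lab @: ~: A|)%N.
Proof.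
move=> lab_e; rewrite omega_reps -(card_in_imset (f := lab)).
  by apply/subset_leq_card/imsetS/subsetP=> x /setIdP[].
move=> x y /setIdP[xA /eqP rx] /setIdP[yA /eqP ry] eq_lab.
by apply/eqP; rewrite -rx -ry comp_rootP lab_e // -in_setC.
Qed.

Lemma omega_le1_connected A : (omega e A <= 1)%N -> connected_on e (~: A).
Proof.
rewrite omega_reps => /card_le1_eqP le1 x y xA yA; rewrite -comp_rootP.
by apply/eqP; apply: le1; apply: comp_root_reps; rewrite -in_setC.
Qed.

Lemma connected_omega_le1 A : connected_on e (~: A) -> (omega e A <= 1)%N.
Proof.
move=> cA; apply: leq_trans (leq_omega_label (lab := fun=> tt) _) _.
  by move=> x y xA yA _; apply: cA; rewrite inE.
by rewrite (leq_trans (max_card _)) // card_unit.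
Qed.

Lemma connected_omega1 A : connected_on e (~: A) -> ~: A != set0 ->
  omega e A = 1%N.
Proof.
move=> cA /set0Pn[x xA]; apply/eqP; rewrite eqn_leq connected_omega_le1 //=.
rewrite omega_reps card_gt0; apply/set0Pn.
by exists (comp_root e A x); rewrite comp_root_reps -?in_setC.
Qed.

(** Sending each old component to the one containing it once [v] is restored is onto, as the
    component of [v] contains [u1], but not injective, as those of [u1] and [u2] merge. *)
Lemma separating_omega_lt A v :
  separating e A -> v \in A -> (omega e (A :\ v) < omega e A)%N.
Proof.
move=> /'forall_implyP/(_ v)/[apply] /existsP[u1 /existsP[u2]].
case/and5P=> u1A u2A evu1 evu2; rewrite -comp_rootP => ne_u.
pose r := comp_root e (A :\ v).
have r_edge x y : x \notin A -> y \notin A -> e x y -> r x = r y.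
  by move=> xA yA; apply: comp_root_edge; rewrite inE negb_and (xA, yA) orbT.
have r_root x : r (comp_root e A x) = r x.
  have := connect_root (restrict_rel e (~: A)) x.
  move/connect_invariant=> /(_ _ r) -> // y z /and3P[].
  by rewrite !inE; apply: r_edge.
have rv u : u \notin A -> e v u -> r u = r v.
  move=> uA evu; apply/esym/comp_root_edge => //; first by rewrite !inE eqxx.
  by rewrite inE negb_and uA orbT.
have subR : comp_reps e (A :\ v) \subset r @: comp_reps e A.
  apply/subsetP=> x; rewrite !inE => /andP[xA /eqP/esym rx].
  have [eq_xv|ne_xv] := eqVneq x v.
    by rewrite {1}rx -/(r x) eq_xv -(rv u1) // -r_root imset_f ?comp_root_reps.
  by rewrite {1}rx -/(r x) -r_root imset_f ?comp_root_reps //; move: xA; rewrite ne_xv.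
rewrite !omega_reps; apply: leq_ltn_trans (subset_leq_card subR) _.
rewrite ltn_neqAle leq_imset_card andbT; apply: contra ne_u => /imset_injP inj_r.
by apply/eqP/inj_r; rewrite ?comp_root_reps // !r_root !rv.
Qed.

Lemma separating_cutset A : separating e A -> cutset e A.
Proof. by move=> sA; right=> v; apply: separating_omega_lt. Qed.

Lemma not_separated_connect A v :
  ~~ [exists u1, [exists u2, [&& u1 \notin A, u2 \notin A, e v u1, e v u2
        & ~~ connect (restrict_rel e (~: A)) u1 u2]]] ->
  forall x y, x \notin A -> y \notin A -> v \in A ->
    connect (restrict_rel e (~: (A :\ v))) x y ->
    connect (restrict_rel e (~: A)) x y.
Proof.
move=> nsep x y xA yA vA.
have nsepP u1 u2 : u1 \notin A -> u2 \notin A -> e v u1 -> e v u2 ->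
    comp_root e A u1 = comp_root e A u2.
  move=> u1A u2A e1 e2; apply/eqP; rewrite comp_rootP; move: nsep.
  move/existsPn/(_ u1)/existsPn/(_ u2).
  by rewrite u1A u2A e1 e2 /= negbK.
(* The neighbours of [v] outside [A] lie in one component, whose label is extended to [v]; the value
   [v] is a dummy for when there is no such neighbour. *)
pose lab z := if z == v then
   (if [pick u | (u \notin A) && e v u] is Some u then comp_root e A u else v)
   else comp_root e A z.
have labv z : z \notin A -> e v z -> lab z = lab v.
  move=> zA evz; rewrite /lab eqxx; case: eqP => [zv|_]; first by rewrite zv vA in zA.
  case: pickP => [u /andP[uA evu]|/(_ z)]; first exact: nsepP.
  by rewrite zA evz.
have labA z : z \notin A -> lab z = comp_root e A z.
  by rewrite /lab; case: eqP vA => // <- ->.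
move=> cxy; rewrite -comp_rootP -!labA //; apply/eqP.
move: cxy; apply: connect_invariant => {x y xA yA} x y /and3P[].
rewrite !inE !negb_and !negbK => /orP[/eqP->|xA] /orP[/eqP->|yA] exy //.
- by rewrite (labv y).
- by rewrite (labv x) // e_sym.
- by rewrite !labA //; apply: comp_root_edge.
Qed.

End Components.

(** * Chains of prime ideals *)

Section PrimeChains.
Variable R : comNzRingType.
Implicit Types (P Q : R -> Prop) (S : R -> Prop).

Lemma is_ideal_gen S : is_ideal (gen_ideal S).
Proof.
split; first by exists [::]; rewrite big_nil.
split=> [a b [s [sS ->]] [t [tS ->]]|r a [s [sS ->]]].
  exists (s ++ t); rewrite big_cat; split=> // q.
  by rewrite mem_cat => /orP[/sS|/tS].
exists [seq (r * q.1, q.2) | q <- s]; split=> [q /mapP[q' /sS ? ->] //|].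
by rewrite big_map mulr_sumr; apply: eq_bigr => q _; rewrite mulrA.
Qed.

Lemma mem_gen_ideal S g : S g -> gen_ideal S g.
Proof.
move=> Sg; exists [:: (1, g)]; rewrite big_seq1 mul1r.
by split=> // q; rewrite inE => /eqP->.
Qed.

Lemma gen_ideal_sub S P : is_ideal P -> (forall g, S g -> P g) ->
  forall g, gen_ideal S g -> P g.
Proof.
move=> [P0 [PD PM]] SP g [s [sS ->]]; elim: s sS => [|q s IHs] sS.
  by rewrite big_nil.
rewrite big_cons; apply: PD; first by apply/PM/SP/sS/mem_head.
by apply: IHs => q' q's; apply: sS; rewrite inE q's orbT.
Qed.

Lemma is_ideal_sum P (I : Type) (r : seq I) (p : pred I) (F : I -> R) :
  is_ideal P -> (forall i, p i -> P (F i)) -> P (\sum_(i <- r | p i) F i).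
Proof. by move=> [P0 [PD _]] PF; apply: (big_ind P). Qed.

Lemma is_ideal_mulr P a b : is_ideal P -> P a -> P (a * b).
Proof. by move=> [_ [_ PM]] Pa; rewrite mulrC; apply: PM. Qed.

Lemma is_ideal_sub P a b : is_ideal P -> P a -> P b -> P (a - b).
Proof. by move=> [_ [PD PM]] Pa Pb; apply: PD => //; rewrite -mulN1r; apply: PM. Qed.

Lemma prime_prod P (I : finType) (F : I -> R) :
  is_prime_ideal P -> P (\prod_i F i) -> exists i, P (F i).
Proof.
move=> [_ [P1 PM]]; rewrite -big_enum; elim: (enum I) => [|i s IHs].
  by rewrite big_nil.
by rewrite big_cons => /PM[Pi|/IHs//]; exists i.
Qed.

Lemma is_prime_ideal_ext P Q :
  (forall g, P g <-> Q g) -> is_prime_ideal P -> is_prime_ideal Q.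
Proof.
move=> eqPQ [[P0 [PD PM]] [P1 PMM]]; split; last split; first split.
- exact/eqPQ.
- split=> [a b /eqPQ Pa /eqPQ Pb|r a /eqPQ Pa]; apply/eqPQ; last exact: PM.
  exact: PD.
- by move/eqPQ.
- by move=> a b /eqPQ/PMM[]/eqPQ; [left|right].
Qed.

Lemma prime_chain_below0 P : is_prime_ideal P -> prime_chain_below P 0.
Proof. by move=> prP; exists (fun=> P). Qed.

Lemma prime_chain_belowS P Q k : is_prime_ideal Q -> strict_incl P Q ->
  prime_chain_below P k -> prime_chain_below Q k.+1.
Proof.
move=> prQ ltPQ [c [ck [prc ltc]]].
exists (fun i => if (i <= k)%N then c i else Q); rewrite ltnn; split=> //.
split=> i; first by case: (leqP i k) => // le_ik _; apply: prc.
rewrite ltnS => le_ik; rewrite le_ik; case: (ltnP i k) => [/ltc//|le_ki].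
by have -> : i = k; [apply/eqP; rewrite eqn_leq le_ik|rewrite ck].
Qed.

Lemma prime_chain_below_le P k j :
  (j <= k)%N -> prime_chain_below P k -> prime_chain_below P j.
Proof.
move=> le_jk [c [ck [prc ltc]]]; exists (fun i => c (i + (k - j))%N).
rewrite subnKC //; split=> //; split=> i ij.
  by apply: prc; rewrite -[X in (_ <= X)%N](subnKC le_jk) leq_add2r.
by rewrite addSn; apply: ltc; rewrite -[X in (_ < X)%N](subnKC le_jk) ltn_add2r.
Qed.

(** Chains end at their prime by Leibniz equality of predicates, so passing to an equivalent
    predicate means replacing the last term. *)
Lemma prime_chain_below_ext P Q k :
  (forall g, P g <-> Q g) -> prime_chain_below P k -> prime_chain_below Q k.
Proof.
move=> eqPQ [c [ck [prc ltc]]].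
exists (fun i => if i == k then Q else c i); rewrite eqxx; split=> //.
split=> i; last first.
  move=> lt_ik; rewrite (ltn_eqF lt_ik); case: eqP => [eq_k|_]; last exact: ltc.
  have := ltc _ lt_ik; rewrite eq_k ck => -[sub [x [Px ncx]]].
  by split=> [y /sub/eqPQ //|]; exists x; split=> //; apply/eqPQ.
case: eqP => [->|_]; last exact: prc.
by move=> _; apply: is_prime_ideal_ext eqPQ _; rewrite -ck; apply: prc.
Qed.

Lemma prime_chain_below_sets (V : finType) (F : {set V} -> R -> Prop)
    (A B : {set V}) k :
  A \subset B -> (forall S : {set V}, is_prime_ideal (F S)) ->
  (forall (S : {set V}) i, A \subset S -> S \subset B -> i \in B -> i \notin S ->
     strict_incl (F S) (F (i |: S))) ->
  prime_chain_below (F A) k -> prime_chain_below (F B) (k + #|B :\: A|).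
Proof.
move=> sAB prF ltF chA; have [n le_n] := ubnP #|B :\: A|.
elim: n => // n IHn in A k sAB ltF chA le_n *.
have [BA0|[i]] := set_0Vmem (B :\: A).
  suff <- : A = B by rewrite setDv cards0 addn0.
  by apply/eqP; rewrite eqEsubset sAB -setD_eq0 BA0 eqxx.
rewrite inE => /andP[iA iB]; rewrite (cardsD1 i) inE iA iB addnA addn1.
have -> : (B :\: A) :\ i = B :\: (i |: A).
  by rewrite setDDl setUC.
apply: IHn.
- by rewrite subUset sub1set iB.
- by move=> S j /subsetP sAS; apply: ltF; apply/subsetP=> x xA; rewrite sAS // inE xA orbT.
- apply: prime_chain_belowS chA => //; exact: ltF.
- apply: leq_trans (proper_card _) (_ : #|B :\: A| <= n)%N; last by [].
  rewrite properE setDS ?subsetUr //=; apply/subsetPn; exists i.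
    by rewrite inE iA.
  by rewrite !inE eqxx.
Qed.

End PrimeChains.

(** * Bounding the length of prime chains by the number of variables *)

Section Growth.
Variables (k : fieldType) (N : nat).
Local Notation R := {mpoly k[N]}.
Implicit Types (P Q : R -> Prop).

Definition indep_mod P (I : finType) (g : I -> R) :=
  forall c : I -> k, P (\sum_i c i *: g i) -> forall i, c i = 0.

(** Modulo [Q], where [f] vanishes, a relation loses all but its constant term in [f], which is
    therefore 0 by independence. Then [f], not being in the prime [P], is cancelled, and the
    argument repeats. *)
Lemma indep_mod_powers P Q f (I : finType) (g : I -> R) D :
  is_prime_ideal P -> is_prime_ideal Q -> (forall h, P h -> Q h) ->
  Q f -> ~ P f -> indep_mod Q g ->
  indep_mod P (fun ij : I * 'I_D => g ij.1 * f ^+ ij.2).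
Proof.
move=> [idP [_ PM]] [idQ _] subPQ Qf nPf gQ c Pc.
have main (A : nat -> R) : (forall j, Q (A j) -> A j = 0) ->
    P (\sum_(j < D) A j * f ^+ j) -> forall j, (j < D)%N -> Q (A j).
  elim: D {c Pc} A => // D IHD A QA; rewrite big_ord_recl expr0 mulr1.
  have -> : \sum_(i < D) A (lift ord0 i) * f ^+ lift ord0 i =
      f * \sum_(i < D) A i.+1 * f ^+ i.
    by rewrite mulr_sumr; apply: eq_bigr => i _; rewrite exprS mulrCA.
  move=> PA; have QA0 : Q (A 0%N).
    have := is_ideal_sub idQ (subPQ _ PA) (is_ideal_mulr (\sum_(i < D) A i.+1 * f ^+ i) idQ Qf).
    by rewrite addrK.
  move: PA; rewrite (QA _ QA0) add0r => /PM[//|PA] [|j] //.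
  by apply: (IHD (fun j => A j.+1)) => // i; apply: QA.
(* [insub] extends the coefficients by 0 beyond [D], since [main] speaks of sequences indexed by
   [nat]. *)
case=> i j; pose A j := \sum_i (if insub j is Some j' then c (i, j') else 0) *: g i.
have Aj (j' : 'I_D) : A j' = \sum_i c (i, j') *: g i.
  by apply: eq_bigr => i' _; rewrite valK.
have cA (j' : nat) : Q (A j') ->
    forall i, (if insub j' is Some j' then c (i, j') else 0) = 0.
  exact: gQ.
have := cA j; rewrite valK; apply; apply: main => // [j' /cA c0|].
  by rewrite /A big1 // => i' _; rewrite c0 scale0r.
suff -> : \sum_(j < D) A j * f ^+ j = \sum_i0 c i0 *: (g i0.1 * f ^+ i0.2) by [].
rewrite (eq_bigr (fun j : 'I_D => \sum_i c (i, j) *: (g i * f ^+ j))).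
  by rewrite exchange_big pair_big; apply: eq_bigr => -[].
move=> j' _; rewrite Aj mulr_suml.
by apply: eq_bigr => i' _; rewrite scalerAl.
Qed.

Lemma card_bmultinom_le B : (#|{: 'X_{1..N < B}}| <= B ^ N)%N.
Proof.
case: B => [|B]; first by rewrite (eq_card0 (A := _)) // => m; have := bmdeg m.
pose F (m : 'X_{1..N < B.+1}) : {ffun 'I_N -> 'I_B.+1} := [ffun i => inord (m i)].
have F_inj : injective F.
  move=> m1 m2 /ffunP eqF; apply/val_inj/mnmP => i.
  have lt_m (m : 'X_{1..N < B.+1}) : (m i < B.+1)%N.
    apply: leq_ltn_trans (bmdeg m); rewrite mdegE (bigD1 i) //=; exact: leq_addr.
  by have := congr1 val (eqF i); rewrite !ffunE /= !inordK.
by rewrite (leq_trans (leq_card F F_inj)) // card_ffun !card_ord.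
Qed.

(** As [P] contains 0, the coefficient matrix, with one column per monomial of degree less than [B],
    has independent rows. *)
Lemma indep_mod_card P (I : finType) (g : I -> R) B :
  is_ideal P -> indep_mod P g -> (forall i, (msize (g i) <= B)%N) ->
  (#|I| <= B ^ N)%N.
Proof.
move=> [P0 _] gP szg; apply: leq_trans (card_bmultinom_le B).
pose M := \matrix_(i < #|I|, j < #|{: 'X_{1..N < B}}|)
  (g (enum_val i))@_(enum_val j : 'X_{1..N < B}).
have : row_free M.
  apply/inj_row_free => v vM0; apply/rowP=> i; rewrite mxE.
  have g0 : \sum_i v 0 (enum_rank i) *: g i = 0.
    apply/mpolyP=> m; rewrite mcoeff0 raddf_sum /=.
    have [lt_mB|le_Bm] := ltnP (mdeg m) B.
      have := congr1 (fun w : 'rV_ _ => w 0 (enum_rank (BMultinom lt_mB))) vM0.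
      rewrite !mxE => M0; apply: etrans M0.
      rewrite (reindex (enum_val : 'I_#|I| -> I)) /=; last first.
        by apply: onW_bij; apply: enum_val_bij.
      by apply: eq_bigr => j _; rewrite mcoeffZ mxE enum_valK enum_rankK.
    rewrite big1 // => j _; rewrite mcoeffZ memN_msupp_eq0 ?mulr0 //.
    by apply: msize_mdeg_ge; apply: leq_trans (szg j) le_Bm.
  have := gP (fun i => v 0 (enum_rank i)); rewrite g0 => /(_ P0 (enum_val i)).
  by rewrite enum_valK.
rewrite -row_leq_rank => le_rk; exact: leq_trans le_rk (rank_leq_col M).
Qed.

Lemma msize_expM_le (p f : R) B D j :
  (msize p <= B)%N -> (j <= D)%N -> (msize (p * f ^+ j) <= B + D * (msize f).+1)%N.
Proof.
move=> szp le_jD; apply: leq_trans (_ : msize p + j * (msize f).+1 <= _)%N.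
  elim: j {le_jD} => [|j IHj]; first by rewrite expr0 mulr1 leq_addr.
  rewrite exprS mulrCA mulrC; apply: leq_trans (msizeM_le _ _) _.
  by rewrite -addnS mulSn addnCA [X in (_ <= X)%N]addnC leq_add2r.
by rewrite leq_add // leq_mul2r le_jD orbT.
Qed.

(** One step down the chain multiplies the family by [D], through the powers of an [f] in the larger
    prime only, and adds at most [D] times a constant to the sizes. [E] depends on the chain alone,
    so that [D] can be taken large. *)
Lemma prime_chain_growth P n : prime_chain_below P n ->
  exists E, forall D B (I : finType) (g : I -> R),
    indep_mod P g -> (forall i, (msize (g i) <= B)%N) ->
    (#|I| * D ^ n <= (B + D * E) ^ N)%N.
Proof.
case=> c [<- [prc ltc]] {P}; elim: n => [|n IHn] in prc ltc *.
  exists 0%N => D B I g gP szg; rewrite expn0 muln1 muln0 addn0.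
  by apply: (indep_mod_card _ gP szg); case: (prc 0%N).
have [||E IHE] := IHn.
- by move=> i le_in; apply: prc; apply: leqW.
- by move=> i lt_in; apply: ltc; apply: leqW.
have [sub [f [Qf nPf]]] := ltc n (leqnn _).
exists ((msize f).+1 + E)%N => D B I g gP szg; rewrite mulnDr addnA expnS mulnA.
rewrite -[D in (#|I| * D)%N]card_ord -card_prod.
apply: IHE (indep_mod_powers _ _ sub Qf nPf gP) _ => [||[i j] /=].
- exact: prc.
- exact: prc.
- by apply: msize_expM_le => //; apply/ltnW.
Qed.

Lemma prime_chain_below_leN P n : prime_chain_below P n -> (n <= N)%N.
Proof.
move=> chP; have [E HE] := prime_chain_growth chP.
have prP : is_prime_ideal P by case: chP => c [<- [prc _]]; apply: prc.
have ind1 : indep_mod P (fun _ : unit => 1).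
  move=> a; rewrite (bigD1 tt) //= big1 ?addr0; last by case.
  case: prP => -[_ [_ PM]] [P1 _] Pa []; apply/eqP/negPn/negP => na.
  apply: P1; have := PM (a tt)^-1%:MP _ Pa.
  by rewrite mul_mpolyC scalerA mulVf // scale1r.
rewrite leqNgt; apply/negP => lt_Nn.
(* With [s = msize 1] and [D = C + 1], one has [(s + D E)^N <= D^N C < D^(N+1) <= D^n], against the
   growth bound. *)
pose C := ((msize (1 : R) + E) ^ N)%N.
have := HE C.+1 (msize (1 : R)) _ _ ind1 (fun=> leqnn _).
rewrite card_unit mul1n; apply/negP; rewrite -ltnNge.
apply: leq_ltn_trans (_ : (C.+1 * (msize (1 : R) + E)) ^ N < _)%N.
  have [->|N_gt0] := posnP N; first by rewrite !expn0.
  by rewrite leq_exp2r // mulnDr leq_add2r leq_pmull.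
rewrite expnMn; apply: leq_trans (_ : C.+1 ^ N * C.+1 <= _)%N.
  by rewrite ltn_pmul2l ?expn_gt0.
by rewrite -expnSr leq_pexp2l.
Qed.
End Growth.

(** * Specialisations *)

Section Specialisations.
Variables (k : fieldType) (T : finType).
Local Notation R := (bei_ring k T).
Local Notation x_ := (xvar k).
Local Notation y_ := (yvar k).
Implicit Types (hx hy : T -> R) (u : {set T}) (w : T -> option T).
Implicit Types (i j : T).

Definition bei_subst_tuple hx hy : (#|T| + #|T|).-tuple R :=
  [tuple match fintype.split i with
         | inl j => hx (enum_val j)
         | inr j => hy (enum_val j)
         end | i < #|T| + #|T|].

Definition bei_subst hx hy : {rmorphism R -> R} :=
  GRing.RMorphism.clone _ _ (comp_mpoly (bei_subst_tuple hx hy)) _.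

Lemma bei_substX hx hy i : bei_subst hx hy (x_ i) = hx i.
Proof.
rewrite /bei_subst /= comp_mpolyXU -tnth_nth tnth_mktuple.
by rewrite (unsplitK (inl (enum_rank i))) enum_rankK.
Qed.

Lemma bei_substY hx hy i : bei_subst hx hy (y_ i) = hy i.
Proof.
rewrite /bei_subst /= comp_mpolyXU -tnth_nth tnth_mktuple.
by rewrite (unsplitK (inr (enum_rank i))) enum_rankK.
Qed.

Lemma bei_substZ hx hy c p : bei_subst hx hy (c *: p) = c *: bei_subst hx hy p.
Proof. exact: comp_mpolyZ. Qed.

Lemma bei_subst_comp hx hy (f : {rmorphism R -> R}) p :
  (forall c q, f (c *: q) = c *: f q) ->
  f (bei_subst hx hy p) = bei_subst (f \o hx) (f \o hy) p.
Proof.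
move=> fZ; rewrite /= !comp_mpolyEX raddf_sum; apply: eq_bigr => m _.
apply: etrans (fZ _ _) _; congr (_ *: _); rewrite !comp_mpolyX rmorph_prod.
apply: eq_bigr => i _; rewrite rmorphXn !tnth_mktuple; congr (_ ^+ _).
by case: (fintype.split i).
Qed.

Lemma eq_bei_subst hx hy hx' hy' p :
  hx =1 hx' -> hy =1 hy' -> bei_subst hx hy p = bei_subst hx' hy' p.
Proof.
move=> eqx eqy; congr (comp_mpoly _ p); apply: eq_mktuple => i.
by case: (fintype.split i) => j; rewrite (eqx, eqy).
Qed.

Lemma xvar_neq0 i : x_ i != 0.
Proof.
apply/eqP=> /(congr1 (mcoeff U_(lshift #|T| (enum_rank i)))).
by rewrite mcoeffXU eqxx mcoeff0 => /eqP; rewrite oner_eq0.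
Qed.

Lemma yvar_neq0 i : y_ i != 0.
Proof.
apply/eqP=> /(congr1 (mcoeff U_(rshift #|T| (enum_rank i)))).
by rewrite mcoeffXU eqxx mcoeff0 => /eqP; rewrite oner_eq0.
Qed.

Lemma yvarB_neq0 i j : i != j -> y_ i - y_ j != 0.
Proof.
move=> ne_ij; apply/eqP=> /(congr1 (mcoeff U_(rshift #|T| (enum_rank i)))).
rewrite mcoeffB !mcoeffXU eqxx mcoeff0 eq_rshift (inj_eq enum_rank_inj).
by rewrite [j == i]eq_sym (negPf ne_ij) subr0 => /eqP; rewrite oner_eq0.
Qed.

(** Slopes are named by vertices; [None] names the slope 0. *)
Definition oyvar (o : option T) : R := if o is Some j then y_ j else 0.

(* Since [x_i] is substituted in [y_i] too, killing [x_i] kills both variables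
   of the vertex [i], and [w i] is the slope [y_i / x_i]. *)
Definition spec u w : {rmorphism R -> R} :=
  bei_subst (fun i => if i \in u then 0 else x_ i)
            (fun i => if i \in u then 0 else x_ i * oyvar (w i)).

Definition spec_ker u w : R -> Prop := fun p => spec u w p = 0.

Lemma specX u w i : spec u w (x_ i) = if i \in u then 0 else x_ i.
Proof. exact: bei_substX. Qed.

Lemma specY u w i :
  spec u w (y_ i) = if i \in u then 0 else x_ i * oyvar (w i).
Proof. exact: bei_substY. Qed.

Definition minor (i j : T) : R := x_ i * y_ j - x_ j * y_ i.

Lemma spec_minor u w i j : spec u w (minor i j) =
  if (i \in u) || (j \in u) then 0
  else x_ i * x_ j * (oyvar (w j) - oyvar (w i)).
Proof.
rewrite /minor rmorphB !rmorphM !specX !specY.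
case: (i \in u); first by rewrite mul0r mulr0 subr0.
case: (j \in u); first by rewrite mul0r mulr0 subr0.
by rewrite mulrBr !mulrA [x_ j * x_ i]mulrC.
Qed.

Lemma spec_ker_prime u w : is_prime_ideal (spec_ker u w).
Proof.
split; last split; first split; first exact: raddf0.
- split=> [a b a0 b0|r a a0]; first by rewrite /spec_ker rmorphD a0 b0 addr0.
  by rewrite /spec_ker rmorphM a0 mulr0.
- by rewrite /spec_ker rmorph1 => /eqP; rewrite oner_eq0.
- move=> a b; rewrite /spec_ker rmorphM => /eqP; rewrite mulf_eq0.
  by case/orP=> /eqP; [left|right].
Qed.

(** [spec u' w'] factors through [spec u w], followed by the substitution that kills [x_i] for [i]
    in [u'] and renames slopes by [t]. *)
Lemma spec_ker_sub u w u' w' (t : T -> option T) :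
  u \subset u' -> (forall i, i \notin u' -> w' i = obind t (w i)) ->
  forall p, spec_ker u w p -> spec_ker u' w' p.
Proof.
move=> /subsetP sub_u w'E p p0.
pose s := bei_subst (fun i => if i \in u' then 0 else x_ i) (oyvar \o t).
suff : s (spec u w p) = spec u' w' p by rewrite p0 rmorph0 => /esym.
rewrite bei_subst_comp; last exact: bei_substZ.
apply: eq_bei_subst => i /=; have [iu|iu] := boolP (i \in u).
- by rewrite rmorph0 sub_u.
- by rewrite bei_substX.
- by rewrite rmorph0 sub_u.
- rewrite rmorphM bei_substX; case: ifPn => [_|iu']; first by rewrite mul0r.
  rewrite w'E //; case: (w i) => [j|] /=; last by rewrite rmorph0.
  by rewrite bei_substY.
Qed.

Lemma spec_ker_ext u w w' : (forall i, i \notin u -> w i = w' i) ->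
  forall p, spec_ker u w p <-> spec_ker u w' p.
Proof.
move=> eqw p; split; apply: (spec_ker_sub (t := Some)) => // i iu.
  by rewrite eqw //; case: (w' i).
by rewrite eqw //; case: (w' i).
Qed.

(** This and the next two lemmas are the elementary steps of the chains: killing a vertex, setting a
    slope to 0, identifying two slopes. The polynomials that enter the kernel are [x_i], [y_i] and a
    minor. *)
Lemma spec_ker_lt_kill u w i :
  i \notin u -> strict_incl (spec_ker u w) (spec_ker (i |: u) w).
Proof.
move=> iu; split.
  apply: (spec_ker_sub (t := Some)); first exact: subsetUr.
  by move=> j _; case: (w j).
exists (x_ i); rewrite /spec_ker !specX !inE eqxx (negPf iu); split=> //.
by apply/eqP/xvar_neq0.
Qed.

Lemma spec_ker_lt_zero u w w' t i :
  (forall j, j \notin u -> w' j = obind t (w j)) ->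
  i \notin u -> w i != None -> w' i = None ->
  strict_incl (spec_ker u w) (spec_ker u w').
Proof.
move=> w'E iu wi w'i; split; first by apply: spec_ker_sub w'E.
exists (y_ i); rewrite /spec_ker !specY (negPf iu) w'i mulr0; split=> //.
case: (w i) wi => // j _; apply/eqP.
by rewrite mulf_neq0 ?xvar_neq0 ?yvar_neq0.
Qed.

Lemma spec_ker_lt_merge u w w' t i i' j :
  (forall l, l \notin u -> w' l = obind t (w l)) ->
  i \notin u -> i' \notin u -> w i' = Some j -> w' i' = Some j ->
  w i != Some j -> w i != None -> w' i = Some j ->
  strict_incl (spec_ker u w) (spec_ker u w').
Proof.
move=> w'E iu i'u wi' w'i' wij wi w'i; split; first by apply: spec_ker_sub w'E.
exists (minor i i'); rewrite /spec_ker !spec_minor (negPf iu) (negPf i'u) /=.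
rewrite w'i w'i' wi' subrr mulr0; split=> //; apply/eqP.
rewrite !mulf_neq0 ?xvar_neq0 //.
by case: (w i) wi wij => //= l _ nlj; rewrite yvarB_neq0 // eq_sym.
Qed.

(** * Chains of specialisations through a given prime *)

Section Chain.
Variables (A : {set T}) (r : T -> T).
Hypothesis r_idem : forall i, r (r i) = r i.
Hypothesis r_mem : forall i, (r i \in A) = (i \in A).

(** The chain starts with distinct slopes and no vertex killed. First the vertices of [A] get slope
    0 and the non-roots outside [A] the slope of their root; then [A] is killed, so its vertices
    count twice. *)
Lemma chain_below_spec_ker :
  prime_chain_below (spec_ker A (Some \o r))
    (#|A :|: [set i | r i != i]| + #|A|).
Proof.
pose W1 := A :|: [set i | r i != i].
pose w (W : {set T}) i := if i \in W then if i \in A then None else Some (r i) else Some i.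
have ch0 : prime_chain_below (spec_ker set0 (w set0)) 0.
  exact/prime_chain_below0/spec_ker_prime.
have ch1 : prime_chain_below (spec_ker set0 (w W1)) #|W1|.
  have := prime_chain_below_sets (F := fun W => spec_ker set0 (w W))
    (sub0set W1) _ _ ch0.
  rewrite setD0; apply=> [S|S i _ /subsetP sSW iW iS]; first exact: spec_ker_prime.
  pose t j := if j == i then if i \in A then None else Some (r i) else Some j.
  have wE l : l \notin set0 -> w (i |: S) l = obind t (w S l).
    move=> _; rewrite /w !inE; have [->|ne_li] := eqVneq l i.
      by rewrite (negPf iS) /= /t eqxx.
    case lS: (l \in S) => /=; last by rewrite /t (negPf ne_li).
    case: ifPn => //= lA; rewrite /t; case: eqP => // rl.
    case: ifPn => [|iA]; first by rewrite -rl r_mem (negPf lA).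
    by rewrite -rl r_idem.
  have [iA|iA] := boolP (i \in A).
    by apply: (spec_ker_lt_zero (i := i) wE); rewrite ?inE // /w ?inE ?eqxx ?iA // (negPf iS).
  have ri : r i != i by move: iW; rewrite !inE (negPf iA).
  (* Being a root outside [A], [r i] still carries its own slope, which differs from that of [i]. *)
  have riS : r i \notin S.
    by apply/negP=> /sSW; rewrite !inE r_mem (negPf iA) r_idem eqxx.
  apply: (spec_ker_lt_merge (i := i) (i' := r i) (j := r i) wE);
    rewrite ?inE // /w ?inE ?eqxx ?(negPf iA) ?(negPf iS) ?(negPf riS) ?(negPf ri) //.
  by rewrite eq_sym.
have ch2 : prime_chain_below (spec_ker A (w W1)) (#|W1| + #|A|).
  have := prime_chain_below_sets (F := fun U => spec_ker U (w W1))
    (sub0set A) _ _ ch1.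
  rewrite setD0; apply=> [S|S i _ _ _ iS]; first exact: spec_ker_prime.
  exact: spec_ker_lt_kill.
apply: prime_chain_below_ext ch2; apply: spec_ker_ext => i iA.
by rewrite /w !inE (negPf iA) /=; case: eqP => //= ->.
Qed.

(** The slopes are set to 0 one root at a time, after which the vertices outside [A] are killed. *)
Lemma chain_above_spec_ker n : prime_chain_below (spec_ker A (Some \o r)) n ->
  exists P : R -> Prop, prime_chain_below P
    (n + #|[set i in ~: A | r i == i]| + #|~: A|).
Proof.
set Z1 := [set i in ~: A | _] => ch.
pose w (Z : {set T}) i := if r i \in Z then None else Some (r i).
have ch0 : prime_chain_below (spec_ker A (w set0)) n.
  by apply: prime_chain_below_ext ch; apply: spec_ker_ext => i _; rewrite /w inE.
have ch1 : prime_chain_below (spec_ker A (w Z1)) (n + #|Z1|).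
  have := prime_chain_below_sets (F := fun Z => spec_ker A (w Z)) (sub0set Z1) _ _ ch0.
  rewrite setD0; apply=> [S|S i _ _]; first exact: spec_ker_prime.
  case/setIdP; rewrite inE => iA /eqP ri iS.
  pose t j := if j == i then None else Some j.
  apply: (spec_ker_lt_zero (i := i) (t := t)) => // [j _||].
  - by rewrite /w !inE; case: (r j \in S); rewrite ?orbT //= /t; case: eqP.
  - by rewrite /w ri (negPf iS).
  - by rewrite /w ri !inE eqxx.
exists (spec_ker setT (w Z1)); rewrite -setTD.
apply: (prime_chain_below_sets (F := fun U => spec_ker U (w Z1)) (subsetT A) _ _ ch1).
  by move=> S; apply: spec_ker_prime.
by move=> S i _ _ _ iS; apply: spec_ker_lt_kill.
Qed.

(** A chain below, continued by the one above, has at most as many steps as there are variables,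
    which bounds [n]; the explicit chain below attains the bound. *)
Lemma chain_below_spec_kerP n : prime_chain_below (spec_ker A (Some \o r)) n <->
  (n + #|[set i in ~: A | r i == i]| <= #|T| + #|A|)%N.
Proof.
set c := #|_|.
have card1 : (#|A :|: [set i | r i != i]| + c = #|T|)%N.
  rewrite -(cardsC (A :|: [set i | r i != i])); congr (_ + #|pred_of_set _|)%N.
  by apply/setP=> i; rewrite !inE negb_or negbK.
split=> [ch|le_n].
  have [P /prime_chain_below_leN] := chain_above_spec_ker ch.
  by rewrite -{2}(cardsC A) addnA leq_add2r.
apply: prime_chain_below_le chain_below_spec_ker.
by rewrite -(leq_add2r c) addnAC card1.
Qed.

End Chain.
End Specialisations.

(** * The binomial edge ideal as an intersection of primes *)

Section EdgeIdeal.
Variables (k : fieldType) (T : finType) (e : rel T).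
Hypotheses (e_sym : ssrbool.symmetric e) (e_irr : ssrbool.irreflexive e).
Local Notation R := (bei_ring k T).
Local Notation x_ := (xvar k).
Local Notation y_ := (yvar k).
Local Notation J := (binomial_edge_ideal k e).
Implicit Types (A : {set T}) (i j l : T) (a b : T -> nat).

Definition comp_ideal A : R -> Prop := spec_ker A (Some \o comp_root e A).

Lemma edge_ideal_is_ideal : is_ideal J.
Proof. exact: is_ideal_gen. Qed.

Lemma edge_ideal_sub_comp_ideal A f : J f -> comp_ideal A f.
Proof.
apply: gen_ideal_sub => [|g]; first by case: (@spec_ker_prime k T A (Some \o comp_root e A)).
move=> [i [j [eij [_ ->]]]]; rewrite /comp_ideal /spec_ker -/(minor k i j).
rewrite spec_minor; case: ifPn => //; rewrite negb_or => /andP[iA jA].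
by rewrite /= (comp_root_edge e_sym iA jA eij) subrr mulr0.
Qed.

Lemma edge_minor i j : e i j -> J (minor k i j).
Proof.
move=> eij; have := ltngtP (enum_rank i) (enum_rank j).
case=> [lt_ij|lt_ji|/val_inj/enum_rank_inj eq_ij].
- by apply: mem_gen_ideal; exists i, j.
- have -> : minor k i j = 0 - minor k j i by rewrite sub0r opprB.
  apply: is_ideal_sub edge_ideal_is_ideal _ _; first by case: edge_ideal_is_ideal.
  by apply: mem_gen_ideal; exists j, i; rewrite e_sym.
- by rewrite eq_ij e_irr in eij.
Qed.

(* By the Pluecker relation [z_l d_it = z_i d_lt + z_t d_il], for [z = x] and
   for [z = y]. *)
Lemma path_minor (z : T -> R) i l (p : seq T) :
  (forall i, z i = x_ i \/ z i = y_ i) -> path e i (l :: p) ->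
  J ((\prod_(q <- belast l p) z q) * minor k i (last l p)).
Proof.
move=> zE; have [_ [JD JM]] := edge_ideal_is_ideal.
elim: p i l => [|l' p IHp] i l; first by rewrite big_nil mul1r /= andbT => /edge_minor.
rewrite [path e i _]/= => /andP[eil pl]; rewrite [belast _ _]/= big_cons [last _ _]/=.
set t := last l' p; set Q := \prod_(q <- _) _.
have mem w : J (w i * (Q * minor k l t) + w t * Q * minor k i l).
  by apply: JD; apply: JM; [apply: IHp|apply: edge_minor].
case: (zE l) => ->; [move: (mem x_)|move: (mem y_)]; congr (J _).
  by rewrite /minor; ring.
by rewrite /minor; ring.
Qed.

(** [b i] counts the particles at [i], and [a i + b i] is the degree at [i], which moves
    preserve. *)
Definition bmon a b : R := \prod_i (x_ i ^+ a i * y_ i ^+ b i).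

Lemma eq_bmon a b a' b' : a =1 a' -> b =1 b' -> bmon a b = bmon a' b'.
Proof. by move=> ea eb; apply: eq_bigr => i _; rewrite ea eb. Qed.

Lemma bmonM a b a' b' : bmon a b * bmon a' b' =
  bmon (fun i => a i + a' i)%N (fun i => b i + b' i)%N.
Proof.
rewrite /bmon -big_split; apply: eq_bigr => i _ /=.
by rewrite !exprD mulrACA.
Qed.

Lemma bmon1 i j : bmon (fun l => l == i) (fun l => l == j) = x_ i * y_ j.
Proof.
rewrite /bmon big_split /=; congr (_ * _).
  by rewrite (bigD1 i) //= eqxx expr1 big1 ?mulr1 // => l /negPf->.
by rewrite (bigD1 j) //= eqxx expr1 big1 ?mulr1 // => l /negPf->.
Qed.

(* A particle moves along a path whose interior is covered by the support: the
   monomial is divisible by one variable of each interior vertex, as [path_minor]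
   requires. *)
Lemma bmon_move a b i j :
  connect (restrict_rel e [set l | 0 < a l + b l]%N) i j -> i != j ->
  (0 < b i)%N -> (0 < a j)%N ->
  J (bmon a b - bmon (fun l => a l + (l == i) - (l == j))%N
                     (fun l => b l + (l == j) - (l == i))%N).
Proof.
set S := [set l | _]; case/connectP=> q /shortenP[p + + _] {q} -> {j}.
case: p => [|s p] pathp uniqp; first by rewrite eqxx.
set j := last i (s :: p) => ne_ij bi aj.
pose B := belast s p.
have defp : s :: p = rcons B j by rewrite /B lastI.
have [uB jB] : uniq B /\ j \notin B.
  move: uniqp => /andP[_]; rewrite -/(uniq (s :: p)) defp rcons_uniq.
  by case/andP.
have iB : i \notin B.
  by move: uniqp => /andP[+ _]; rewrite defp mem_rcons inE negb_or => /andP[].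
have BS l : l \in B -> (0 < a l + b l)%N.
  move=> lB; have : l \in s :: p by rewrite defp mem_rcons inE lB orbT.
  elim: (s :: p) {1}i pathp {lB} => //= l' p' IHp' i' /andP[/and3P[_ l'S _] /IHp'{}IHp'].
  by rewrite inE => /predU1P[->|//]; move: l'S; rewrite inE.
(* At each interior vertex of the path one variable of the monomial is selected, [x] if available
   and [y] otherwise. [c] and [d] are the exponents of their product; [a2] and [b2] below are those
   of the remaining cofactor. *)
pose c l : nat := (l \in B) && (0 < a l)%N; pose d l : nat := (l \in B) && (a l == 0)%N.
pose z l := if (0 < a l)%N then x_ l else y_ l.
have prodz : \prod_(q <- B) z q = bmon c d.
  rewrite big_uniq //= big_mkcond; apply: eq_bigr => l _.
  rewrite /c /d /z; case: (l \in B) => /=; last by rewrite mulr1.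
  by case: (a l) => [|al]; rewrite /= ?expr0 ?expr1 ?mulr1 ?mul1r.
pose a2 l := (a l - (l == j) - c l)%N; pose b2 l := (b l - (l == i) - d l)%N.
have -> : bmon a b = x_ j * y_ i * bmon c d * bmon a2 b2.
  rewrite -bmon1 !bmonM; apply: eq_bmon => l; rewrite /a2 /b2 /c /d.
    have [->|ne_lj] := eqVneq l j; first by rewrite (negPf jB); lia.
    by case: (l \in B) => /=; lia.
  have [->|ne_li] := eqVneq l i; first by rewrite (negPf iB); lia.
  case: (boolP (l \in B)) => [/BS|_] /=; lia.
have -> : bmon (fun l => a l + (l == i) - (l == j))%N
    (fun l => b l + (l == j) - (l == i))%N = x_ i * y_ j * bmon c d * bmon a2 b2.
  rewrite -bmon1 !bmonM; apply: eq_bmon => l; rewrite /a2 /b2 /c /d.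
    have [->|ne_lj] := eqVneq l j.
      by rewrite (negPf jB) eq_sym (negPf ne_ij); lia.
    by case: (l \in B) => /=; lia.
  have [->|ne_li] := eqVneq l i; first by rewrite (negPf iB); lia.
  case: (boolP (l \in B)) => [/BS|_] /=; lia.
have Jm : J ((\prod_(q <- B) z q) * minor k i j).
  apply: path_minor; first by move=> l; rewrite /z; case: ifP; [left|right].
  by apply: sub_path pathp => l l' /and3P[].
have [_ [_ JM]] := edge_ideal_is_ideal.
have := JM (- bmon a2 b2) _ Jm; congr (J _).
by rewrite prodz /minor; ring.
Qed.

Lemma sum_eq_exists_lt (P : pred T) b b' i :
  (\sum_(l | P l) b l = \sum_(l | P l) b' l)%N -> P i -> (b' i < b i)%N ->
  exists2 j, P j & (b j < b' j)%N.
Proof.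
move=> eq_sum Pi lt_i; apply/exists_inP; apply: contraT.
rewrite negb_exists_in => /forall_inP ge; move: eq_sum.
rewrite (bigD1 i) //= [in RHS](bigD1 i) //=.
have : (\sum_(l | P l && (l != i)) b' l <= \sum_(l | P l && (l != i)) b l)%N.
  by apply: leq_sum => l /andP[/ge]; rewrite -leqNgt.
lia.
Qed.

(** Induction on the surplus of [b] over [b']: where the two differ, a particle moves from a vertex
    with too many to one of the same component with too few. Degrees, hence the support and its
    components, are unchanged. *)
Lemma bmon_equiv a b a' b' :
  (forall i, a i + b i = a' i + b' i)%N ->
  (forall r, \sum_(l | comp_root e [set l | a l + b l == 0]%N l == r) b l =
             \sum_(l | comp_root e [set l | a l + b l == 0]%N l == r) b' l)%N ->
  J (bmon a b - bmon a' b').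
Proof.
have [n] := ubnP (\sum_l (b l - b' l))%N; elim: n a b => // n IHn a b le_n eq_deg eq_tot.
set A := [set l | _] in eq_tot.
have [/forallP eq_b|] := boolP [forall l, b l == b' l].
  rewrite (@eq_bmon a b a' b') ?subrr; first by case: edge_ideal_is_ideal.
    by move=> l; have := eq_deg l; rewrite (eqP (eq_b l)) => /addIn.
  by move=> l; apply/eqP.
rewrite negb_forall => /existsP[i0 ne_i0].
pose r := comp_root e A i0.
have [i [j [ri rj lt_i lt_j]]] : exists i j, [/\ comp_root e A i == r,
    comp_root e A j == r, b' i < b i & b j < b' j]%N.
  have [lt0|lt0|/eqP] := ltngtP (b i0) (b' i0); last by rewrite (negPf ne_i0).
    have [i ri lt_i] := sum_eq_exists_lt (esym (eq_tot r)) (eqxx r) lt0.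
    by exists i, i0.
  have [j rj lt_j] := sum_eq_exists_lt (eq_tot r) (eqxx r) lt0.
  by exists i0, j.
have ne_ij : i != j by apply: contraTneq lt_i => ->; rewrite -leqNgt ltnW.
have aj : (0 < a j)%N by have := eq_deg j; lia.
pose a1 l := (a l + (l == i) - (l == j))%N.
pose b1 l := (b l + (l == j) - (l == i))%N.
have deg1 l : (a1 l + b1 l = a l + b l)%N.
  rewrite /a1 /b1; have [->|ne_li] := eqVneq l i.
    by rewrite (negPf ne_ij); lia.
  by have [->|ne_lj] := eqVneq l j; lia.
have [_ [JD _]] := edge_ideal_is_ideal.
have -> : bmon a b - bmon a' b' = (bmon a b - bmon a1 b1) + (bmon a1 b1 - bmon a' b').
  by rewrite addrA subrK.
apply: JD.
  apply: bmon_move => //; last by apply: leq_ltn_trans lt_i.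
  rewrite (_ : [set l | _] = ~: A).
    by rewrite -comp_rootP // (eqP ri) (eqP rj).
  by apply/setP=> l; rewrite !inE lt0n.
have A1 : [set l | a1 l + b1 l == 0]%N = A by apply/setP=> l; rewrite !inE deg1.
apply: IHn => [|l|s].
- move: le_n; rewrite ltnS; apply: leq_trans; rewrite (bigD1 i) //= [X in (_ < X)%N](bigD1 i) //=.
  have : (\sum_(l | l != i) (b1 l - b' l) <= \sum_(l | l != i) (b l - b' l))%N.
    apply: leq_sum => l ne_li; rewrite /b1 (negPf ne_li).
    by have [->|_] := eqVneq l j; lia.
  by rewrite /b1 eqxx (negPf ne_ij); lia.
- by rewrite deg1.
- rewrite A1 -eq_tot; apply/eqP.
  have eqS : (\sum_(l | comp_root e A l == s) (b1 l + (l == i)) =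
              \sum_(l | comp_root e A l == s) (b l + (l == j)))%N.
    apply: eq_bigr => l _; rewrite /b1; have [->|ne_li] := eqVneq l i.
      by rewrite (negPf ne_ij); lia.
    by have [->|ne_lj] := eqVneq l j; lia.
  have ind h : (\sum_(l | comp_root e A l == s) (l == h) = (comp_root e A h == s))%N.
    have [hs|hs] := boolP (comp_root e A h == s).
      by rewrite (bigD1 h) //= eqxx big1 // => l /andP[_ /negPf->].
    by rewrite big1 // => l ls; case: eqP => // eq_l; rewrite -eq_l ls in hs.
  by move: eqS; rewrite !big_split /= !ind (eqP ri) (eqP rj) => /addIn ->.
Qed.

End EdgeIdeal.

(** * Classes of monomials and the decomposition of the ideal *)

Lemma sum_by_key (V : nmodType) (M K : eqType) (s : seq M) (h : M -> K)
    (F : M -> V) :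
  \sum_(m <- s) F m = \sum_(c <- undup (map h s)) \sum_(m <- s | h m == c) F m.
Proof.
rewrite (exchange_big_dep predT) //= big_seq [RHS]big_seq.
apply: eq_bigr => m ms; rewrite big_mkcond (bigD1_seq (h m)) ?undup_uniq //=.
  by rewrite eqxx big1 ?addr0 // => c /negPf; rewrite eq_sym => ->.
by rewrite mem_undup map_f.
Qed.

Section EdgeIdealDecomposition.
Variables (k : fieldType) (T : finType) (e : rel T).
Hypotheses (e_sym : ssrbool.symmetric e) (e_irr : ssrbool.irreflexive e).
Local Notation R := (bei_ring k T).
Local Notation N := (#|T| + #|T|)%N.
Local Notation x_ := (xvar k).
Local Notation y_ := (yvar k).
Local Notation J := (binomial_edge_ideal k e).
Implicit Types (A : {set T}) (i j l : T) (m : 'X_{1..N}).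

Definition xdeg m i := m (lshift #|T| (enum_rank i)).
Definition ydeg m i := m (rshift #|T| (enum_rank i)).

Lemma mpolyX_bmon m : 'X_[m] = bmon k (xdeg m) (ydeg m).
Proof.
rewrite mpolyXE_id big_split_ord /= /bmon big_split /=.
congr (_ * _); rewrite (reindex (enum_rank : T -> 'I_#|T|)) //;
  exact/onW_bij/enum_rank_bij.
Qed.

Definition dead m : {set T} := [set i | xdeg m i + ydeg m i == 0]%N.

(** When [A] lies in [dead m], this is the exponent of the specialisation of ['X_[m]] at [A]: the
    [x] part keeps the degrees, the [y] part counts the particles of each component at its root. *)
Definition comp_key A m : 'X_{1..N} :=
  (\sum_i (U_(lshift #|T| (enum_rank i)) *+ (xdeg m i + ydeg m i)
         + U_(rshift #|T| (enum_rank (comp_root e A i))) *+ ydeg m i))%MM.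

Lemma xdeg_comp_key A m i : xdeg (comp_key A m) i = (xdeg m i + ydeg m i)%N.
Proof.
rewrite /xdeg mnm_sumE (bigD1 i) //= big1 ?addn0 => [|j ne_ji];
  rewrite mnmDE !mulmnE !mnm1E eq_rlshift ?mul0n ?addn0 ?eqxx ?mul1n //.
by rewrite eq_lshift (inj_eq enum_rank_inj) (negPf ne_ji).
Qed.

Lemma ydeg_comp_key A m r :
  ydeg (comp_key A m) r = (\sum_(i | comp_root e A i == r) ydeg m i)%N.
Proof.
rewrite {1}/ydeg mnm_sumE [RHS]big_mkcond /=; apply: eq_bigr => i _.
rewrite mnmDE !mulmnE !mnm1E eq_lrshift mul0n add0n.
rewrite eq_rshift (inj_eq enum_rank_inj).
by case: eqP; rewrite ?mul1n.
Qed.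

Lemma spec_vertex_monomial A w i a b :
  spec k A w (x_ i ^+ a * y_ i ^+ b) =
  if (i \in A) && (a + b != 0)%N then 0 else x_ i ^+ (a + b) * oyvar k (w i) ^+ b.
Proof.
transitivity (spec k A w (x_ i) ^+ a * spec k A w (y_ i) ^+ b).
  by apply: etrans (rmorphM _ _ _) _; congr (_ * _); apply: rmorphXn.
rewrite specX specY; case: (i \in A) => /=; last first.
  by rewrite exprMn mulrA -exprD.
rewrite -exprD expr0n; have [/eqP|//] := eqVneq (a + b)%N 0%N.
by rewrite addn_eq0 => /andP[/eqP-> /eqP->]; rewrite !expr0 mulr1.
Qed.

Lemma spec_monomial A m :
  spec k A (Some \o comp_root e A) 'X_[m] =
  if A \subset dead m then 'X_[comp_key A m] else 0.
Proof.
rewrite mpolyX_bmon rmorph_prod; case: ifPn => [/subsetP sA|/subsetPn[i iA]].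
  rewrite -mprodXE; apply: eq_bigr => i _.
  transitivity (x_ i ^+ (xdeg m i + ydeg m i) * y_ (comp_root e A i) ^+ ydeg m i);
    last by apply/esym/(etrans (mpolyXD _ _ _)); congr (_ * _); exact/esym/mpolyXn.
  rewrite spec_vertex_monomial; case: ifP => // /andP[/sA].
  by rewrite inE => /eqP->.
by rewrite inE => nz; rewrite (bigD1 i) // spec_vertex_monomial iA nz; apply: mul0r.
Qed.

Lemma comp_key_inj m m' :
  comp_key (dead m) m = comp_key (dead m') m' ->
  J ('X_[m] - 'X_[m']).
Proof.
move=> eq_key.
have eq_deg i : (xdeg m i + ydeg m i = xdeg m' i + ydeg m' i)%N.
  by rewrite -(xdeg_comp_key (dead m)) eq_key xdeg_comp_key.
have eq_dead : dead m = dead m' by apply/setP=> i; rewrite !inE eq_deg.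
rewrite (mpolyX_bmon m) (mpolyX_bmon m').
apply: (bmon_equiv k e_sym e_irr eq_deg) => r.
by rewrite -/(dead m) -ydeg_comp_key eq_key -eq_dead ydeg_comp_key.
Qed.

(** The left side is what the specialisation at [dead m] detects, the right side says that the
    monomials are in one class. Equal keys, for whatever sets, force equal degrees and so equal
    [dead]. *)
Lemma eq_comp_key m m' :
  (dead m \subset dead m') && (comp_key (dead m) m' == comp_key (dead m) m) =
  (comp_key (dead m') m' == comp_key (dead m) m).
Proof.
have eq_dead A B : comp_key A m' = comp_key B m -> dead m' = dead m.
  by move=> eq_key; apply/setP=> i; rewrite !inE -(xdeg_comp_key A) eq_key xdeg_comp_key.
apply/andP/eqP => [[_ /eqP eq_key]|eq_key].
  by rewrite (eq_dead _ _ eq_key).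
have d := eq_dead _ _ eq_key; rewrite -eq_key d; split; [exact: subxx|exact: eqxx].
Qed.

(* A class of monomials with the same support and the same [comp_key] is read
   off as one coefficient of the specialisation at the complement of that
   support, and any two monomials of the class agree modulo [J]. *)
Lemma edge_idealP f : J f <-> forall A, comp_ideal e A f.
Proof.
split=> [Jf A|f0]; first exact: edge_ideal_sub_comp_ideal.
have idJ := edge_ideal_is_ideal k e; have [J0 [JD JM]] := idJ.
pose K m := comp_key (dead m) m.
rewrite [f]mpolyE (sum_by_key _ K) big_seq; apply: is_ideal_sum => // c.
rewrite mem_undup => /mapP[m0 _ ->]; set s := msupp f.
have JZ a p : J p -> J (a *: p) by rewrite -mul_mpolyC; apply: JM.
(* If the coefficients of a class sum to 0, each ['X_[m]] can be replaced by ['X_[m] - 'X_[m0]],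
   which is in [J]. *)
suff sum0 : \sum_(m <- s | K m == K m0) f@_m = 0.
  have -> : \sum_(m <- s | K m == K m0) f@_m *: 'X_[m] =
      \sum_(m <- s | K m == K m0) f@_m *: ('X_[m] - 'X_[m0]) :> R.
    apply/eqP; rewrite -subr_eq0 -sumrB; under eq_bigr do rewrite scalerBr subKr.
    by rewrite -scaler_suml sum0 scale0r.
  by apply: is_ideal_sum => // m /eqP eqK; apply/JZ/comp_key_inj.
have specE : spec k (dead m0) (Some \o comp_root e (dead m0)) f =
    \sum_(m <- s) f@_m *: spec k (dead m0) (Some \o comp_root e (dead m0)) 'X_[m].
  exact: comp_mpolyEX.
have := congr1 (mcoeff (K m0)) (f0 (dead m0)).
rewrite specE mcoeff0 raddf_sum; apply: etrans; rewrite big_mkcond.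
apply: eq_bigr => m _; apply/esym/(etrans (mcoeffZ _ _ _)).
rewrite spec_monomial /K -eq_comp_key.
case: (_ \subset _); last by rewrite mcoeff0 mulr0.
by rewrite mcoeffX; case: eqP; rewrite ?mulr1 ?mulr0.
Qed.

End EdgeIdealDecomposition.

(** * Associated primes *)

Section AssociatedPrimes.
Variables (k : fieldType) (T : finType) (e : rel T).
Hypotheses (e_sym : ssrbool.symmetric e) (e_irr : ssrbool.irreflexive e).
Local Notation R := (bei_ring k T).
Local Notation J := (binomial_edge_ideal k e).
Local Notation P_ := (comp_ideal (k := k) e).
Implicit Types (A B : {set T}) (f g : R).

Lemma comp_ideal_prime A : is_prime_ideal (P_ A).
Proof. exact: spec_ker_prime. Qed.

Lemma comp_ideal_xvar A v : P_ A (xvar k v) <-> v \in A.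
Proof.
rewrite /comp_ideal /spec_ker specX; case: ifP => //; split=> // /eqP.
by rewrite (negPf (xvar_neq0 k v)).
Qed.

Lemma comp_ideal_minor A i j : i \notin A -> j \notin A ->
  P_ A (minor k i j) <-> comp_root e A i = comp_root e A j.
Proof.
move=> iA jA; rewrite /comp_ideal /spec_ker spec_minor (negPf iA) (negPf jA) /=.
split=> [/eqP|->]; last by rewrite subrr mulr0.
have [//|ne_r] := eqVneq (comp_root e A i) (comp_root e A j); apply: contraTeq => _.
by rewrite !mulf_neq0 ?xvar_neq0 // yvarB_neq0 // eq_sym.
Qed.

(** Restoring [v] merges no components, so the new slope of a component determines the old one: [t]
    finds it through any vertex of the component outside [A]. *)
Lemma comp_ideal_not_separated A v : v \in A ->
  ~~ [exists u1, [exists u2, [&& u1 \notin A, u2 \notin A, e v u1, e v u2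
        & ~~ connect (restrict_rel e (~: A)) u1 u2]]] ->
  forall f, P_ (A :\ v) f -> P_ A f.
Proof.
move=> vA nsep; pose r := comp_root e (A :\ v).
apply: (spec_ker_sub (t := fun j =>
  omap (comp_root e A) [pick i | (i \notin A) && (r i == j)])).
  exact: subsetDl.
move=> i iA /=; case: pickP => [j /andP[jA eq_r]|/(_ i)]; last by rewrite iA eqxx.
congr Some; apply/eqP; rewrite eq_sym comp_rootP //.
by apply: not_separated_connect nsep _ _ _ _ vA _ => //; rewrite -comp_rootP.
Qed.


Lemma chain_below_comp_idealP A n : prime_chain_below (P_ A) n <->
  (n + omega e A <= #|T| + #|A|)%N.
Proof.
rewrite omega_reps //; apply: chain_below_spec_kerP.
  exact: comp_root_idem.
exact: comp_root_mem.
Qed.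


(* Otherwise [done] tries to evaluate polynomial substitutions. *)
Local Opaque comp_ideal.

(** If [B] is not inside [A], a variable works. Otherwise some [v] in [A] but not in [B] joins,
    outside [B], two neighbours that [A] separates, and their minor works. *)
Lemma comp_ideal_minimal A B : separating e A -> B != A ->
  exists f, P_ B f /\ ~ P_ A f.
Proof.
move=> sepA ne_BA; have [sBA|/subsetPn[v vB vA]] := boolP (B \subset A); last first.
  by exists (xvar k v); rewrite !comp_ideal_xvar; split=> //; apply/negP.
have /subsetPn[v vA vB] : ~~ (A \subset B).
  by apply: contra ne_BA => sAB; rewrite eqEsubset sBA.
have /existsP[u1 /existsP[u2 /and5P[u1A u2A e1 e2]]] := implyP (forallP sepA v) vA.
rewrite -comp_rootP // => ne_root.
have notB u : u \notin A -> u \notin B by apply/contra/(subsetP sBA).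
exists (minor k u1 u2); split; last by move/comp_ideal_minor => /(_ u1A u2A)/eqP; apply/negP.
apply/comp_ideal_minor; rewrite ?notB //.
rewrite -(comp_root_edge e_sym vB (notB _ u1A) e1).
exact: (comp_root_edge e_sym vB (notB _ u2A) e2).
Qed.

(** The annihilated element is a product of elements outside [P_ A], one in each [P_ B] with
    [B != A]. As [J] is the intersection of all [P_ B], exactly [P_ A] multiplies it into [J]. *)
Lemma separating_associated A : separating e A -> associated_prime J (P_ A).
Proof.
move=> sepA; split; first exact: comp_ideal_prime.
have /fin_all_exists[F FP] B : exists f, ~ P_ A f /\ (B != A -> P_ B f).
  have [eq_BA|/(comp_ideal_minimal sepA)[f [PBf nPAf]]] := eqVneq B A; last first.
    by exists f; split=> [|_]; [exact: nPAf|exact: PBf].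
  exists 1; split; last by case/eqP.
  exact: (comp_ideal_prime A).2.1.
exists (\prod_B F B) => g; split=> [Pg|/(edge_idealP e_sym e_irr)/(_ A)].
  apply/(edge_idealP e_sym e_irr) => B; have [idB _] := comp_ideal_prime B.
  have [->|ne_BA] := eqVneq B A; first exact: (comp_ideal_prime A).1.2.2.
  rewrite (bigD1 B isT) -mulrA.
  exact: is_ideal_mulr idB ((FP B).2 ne_BA).
have [_ [_ PM]] := comp_ideal_prime A.
by case/PM=> // /(prime_prod (comp_ideal_prime A))[B]; case: (FP B).
Qed.

(** [J : f] is the intersection of the [P_ A] not containing [f]; being prime, it is one of them. *)
Lemma associated_separating P : associated_prime J P ->
  exists2 A, separating e A & forall g, P_ A g <-> P g.
Proof.
case=> prP [f PE].
have PJ g : P g <-> forall A, ~ P_ A f -> P_ A g.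
  rewrite PE (edge_idealP e_sym e_irr); split=> [Jfg A nf|Pg A].
    by have [_ [_ PM]] := comp_ideal_prime A; case: (PM _ _ (Jfg A)).
  have [idA _] := comp_ideal_prime A.
  have [fA|/Pg] := classic (P_ A f).
    exact: is_ideal_mulr idA fA.
  by case: idA => _ [_]; apply.
suff [A [nf PA]] : exists A, ~ P_ A f /\ (forall g, P_ A g <-> P g).
  have [n] := ubnP #|A|; elim: n A nf PA => // n IHn A nf PA le_A.
  have [sepA|] := boolP (separating e A); first by exists A.
  rewrite negb_forall_in => /exists_inP[v vA nsep].
  have sub := comp_ideal_not_separated vA nsep.
  have nf' : ~ P_ (A :\ v) f by move/sub.
  apply: (IHn (A :\ v) nf') => [g|].
    by split=> [Pg|/PJ]; [apply/PA/sub|apply].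
  by move: le_A; rewrite (cardsD1 v A) vA.
(* Otherwise each [P_ A] omitting [f] has an element outside [P], and the product of these lies in
   [P], against primality. *)
apply: NNPP => noA.
have /fin_all_exists[F FP] A : exists g, ~ P g /\ (~ P_ A f -> P_ A g).
  have [nfA|fA] := classic (~ P_ A f); last first.
    by exists 1; split; [exact: prP.2.1|move/fA].
  apply: NNPP => nog; apply: noA; exists A; split; first exact: nfA.
  move=> g; split=> [gA|/PJ]; last exact.
  by apply: NNPP => nPg; apply: nog; exists g; split; [exact: nPg|move=> _; exact: gA].
have /(prime_prod prP)[A] : P (\prod_A F A); last by case: (FP A).
apply/PJ => A nfA; rewrite (bigD1 A isT); have [idA _] := comp_ideal_prime A.
exact: is_ideal_mulr idA ((FP A).2 nfA).
Qed.

Lemma separating0 : separating e set0.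
Proof. by apply/forall_inP => v; rewrite inE. Qed.

Lemma unmixedP : unmixed J <->
  (forall A, separating e A -> omega e A = #|A| + omega e set0)%N.
Proof.
have le_omega A : (omega e A <= #|T|)%N by rewrite omega_reps // max_card.
split=> [unm A sepA|omA P Q /associated_separating[A sA PA] /associated_separating[B sB QB] n].
  have eq_h := unm _ _ (separating_associated sepA) (separating_associated separating0).
  have leA := le_omega A; have le0 := le_omega set0.
  (* The longest chain below each of [P_ A] and [P_ set0] must have a counterpart below the other,
     whence two inequalities. *)
  have le1 : (#|T| + #|A| - omega e A + omega e set0 <= #|T| + #|@set0 T|)%N.
    apply/chain_below_comp_idealP/(eq_h _).1/chain_below_comp_idealP.
    by rewrite subnK // (leq_trans leA) ?leq_addr.
  have le2 : (#|T| - omega e set0 + omega e A <= #|T| + #|A|)%N.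
    apply/chain_below_comp_idealP/(eq_h _).2/chain_below_comp_idealP.
    by rewrite subnK ?leq_addr.
  by move: leA le0 le1 le2; rewrite cards0; lia.
have mono A' B' P' Q' : separating e A' -> separating e B' ->
    (forall g, P_ A' g <-> P' g) -> (forall g, P_ B' g <-> Q' g) ->
    prime_chain_below P' n -> prime_chain_below Q' n.
  move=> sA' sB' eqP' eqQ' ch; apply: (prime_chain_below_ext eqQ').
  have /chain_below_comp_idealP : prime_chain_below (P_ A') n.
    by apply: prime_chain_below_ext ch => g; split=> /eqP'.
  rewrite omA // => le_n; apply/chain_below_comp_idealP; rewrite omA //.
  by move: le_n; lia.
by split; [apply: mono PA QB|apply: mono QB PA].
Qed.

End AssociatedPrimes.

(** * Corona products *)

Lemma not_connect_label (T : finType) (e : rel T) (A : {set T}) (U : eqType)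
    (lab : T -> U) x y :
  (forall x y, x \notin A -> y \notin A -> e x y -> lab x = lab y) ->
  lab x != lab y -> ~~ connect (restrict_rel e (~: A)) x y.
Proof.
move=> lab_e; apply: contra => cxy; apply/eqP; move: cxy.
apply: connect_invariant => {x y} x y /and3P[].
by rewrite !inE; apply: lab_e.
Qed.

Section Corona.
Variables (TG TH : finType) (eG : rel TG) (eH : rel TH) (L : {set TG}).
Hypotheses (symG : ssrbool.symmetric eG) (irrG : ssrbool.irreflexive eG).
Hypotheses (symH : ssrbool.symmetric eH) (irrH : ssrbool.irreflexive eH).
Hypotheses (connG : connected_graph eG) (TG_gt1 : (1 < #|TG|)%N).
Hypotheses (TH_gt0 : (0 < #|TH|)%N).
Hypotheses (L_proper : L \proper [set: TG]).

Local Notation V := (corona_vert TH L).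
Local Notation C := (corona_rel eG eH L).
Local Notation Inl x := (inl x : V).

Lemma corona_sym : ssrbool.symmetric C.
Proof.
move=> [u|[w h]] [u'|[w' h']].
- exact: symG.
- exact: eq_sym.
- exact: eq_sym.
- by congr (_ && _); [exact: eq_sym|exact: symH].
Qed.

Lemma corona_irr : ssrbool.irreflexive C.
Proof. move=> [u|[w h]]; first exact: irrG.
by apply/negP=> /andP[_]; rewrite irrH. Qed.

Lemma mem_inl (A : {set TG}) x : (Inl x \in [set inl y | y in A]) = (x \in A).
Proof. by rewrite mem_imset // => y z []. Qed.

Lemma mem_inr (A : {set TG}) p : ((inr p : V) \in [set inl y | y in A]) = false.
Proof. by apply/imsetP=> -[]. Qed.

Lemma connect_inl (S : {set TG}) (S' : {set V}) x y :
  (forall z, z \in S -> Inl z \in S') ->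
  connect (restrict_rel eG S) x y ->
  connect (restrict_rel C S') (Inl x) (Inl y).
Proof.
move=> SS'; apply: connect_homo => {x y} x y /and3P[xS yS exy].
by rewrite connect1 //; apply/and3P; split; rewrite ?SS'.
Qed.

Lemma corona_connected : connected_on C (~: set0).
Proof.
have to_inl z : exists x, connect (restrict_rel C (~: set0)) z (Inl x).
  case: z => [x|[w h]]; first by exists x; apply: connect0.
  by exists (val w); apply: connect1; rewrite /restrict_rel !inE /= eqxx.
move=> z z' _ _; have [x zx] := to_inl z; have [x' zx'] := to_inl z'.
apply: connect_trans zx _.
rewrite (restrict_connect_sym corona_sym) in zx'; apply: connect_trans _ zx'.
by apply: connect_inl (connG (in_setT x) (in_setT x')) => y; rewrite !inE.
Qed.

Lemma exists_neighbour (A : {set TG}) v z :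
  connected_on eG A -> v \in A -> z \in A -> v != z ->
  exists2 u, u \in A & eG v u.
Proof.
move=> cA vA zA ne_vz; case/connectP: (cA v z vA zA) => -[|u p] /=.
  by move=> _ eq_zv; rewrite eq_zv eqxx in ne_vz.
by case/andP=> /and3P[_ uA evu] _ _; exists u.
Qed.

(** [inl] names a component of [G \ A] together with the copies of [H] hanging on it, [inr] a copy
    cut off by its vertex in [A]. *)
Definition corona_label (A : {set TG}) (z : V) : TG + TG :=
  match z with
  | inl x => inl (comp_root eG A x)
  | inr (w, _) => if val w \in A then inr (val w) else inl (comp_root eG A (val w))
  end.

Lemma corona_label_edge (A : {set TG}) x y :
  x \notin [set Inl y | y in A] -> y \notin [set Inl y | y in A] ->
  C x y -> corona_label A x = corona_label A y.
Proof.
case: x => [x|[w h]]; case: y => [y|[w' h']]; rewrite ?mem_inl ?mem_inr /=.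
- by move=> xA yA exy; rewrite (comp_root_edge symG xA yA exy).
- by move=> xA _ /eqP <-; rewrite (negPf xA).
- by move=> _ yA /eqP ->; rewrite (negPf yA).
- by move=> _ _ /andP[/eqP->].
Qed.

(** Each [v] in [A] touches its own copy of [H] and a vertex of [G \ A]; the latter because [G]
    without [A :\ v] is connected and has a vertex outside [L]. *)
Lemma corona_separating (A : {set TG}) : A \subset L ->
  (forall v, v \in A -> connected_on eG (~: (A :\ v))) ->
  separating C [set Inl x | x in A].
Proof.
move=> /subsetP AL cA; apply/forall_inP=> z /imsetP[v vA ->{z}].
have [h0 _] : exists h0 : TH, h0 \in TH by apply/card_gt0P.
have [_ [z0 _ z0L]] := properP L_proper.
have z0A : z0 \notin A by apply: contra z0L => /AL.
have [|||u uA evu] := exists_neighbour (v := v) (z := z0) (cA v vA).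
- by rewrite !inE eqxx.
- by rewrite !inE (negPf z0A) andbF.
- by apply: contraNneq z0A => <-.
have {}uA : u \notin A.
  apply: contraL uA => uA; rewrite !inE uA andbT negbK.
  by apply: contraTneq evu => ->; rewrite irrG.
apply/existsP; exists (inr (exist _ v (AL v vA), h0)); apply/existsP; exists (Inl u).
rewrite mem_inl mem_inr uA /= evu eqxx /=.
by apply: (not_connect_label (@corona_label_edge A)); rewrite /= vA.
Qed.

Lemma leq_corona_omega (A : {set TG}) : A \subset L ->
  (omega eG A + #|A| <= omega C [set Inl x | x in A])%N.
Proof.
move=> /subsetP AL; have [h0 _] : exists h0 : TH, h0 \in TH by apply/card_gt0P.
apply: leq_trans (leq_label_omega corona_sym (@corona_label_edge A)).
rewrite omega_reps //.
have -> : (#|comp_reps eG A| + #|A|)%N = #|[set (inl x : TG + TG) | x in comp_reps eG A] :|: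
    [set inr x | x in A]|.
  rewrite cardsU !card_imset; try by move=> x y [].
  rewrite (_ : _ :&: _ = set0) ?cards0 ?subn0 //.
  by apply/setP=> z; rewrite !inE; apply/andP=> -[/imsetP[x _ ->] /imsetP[]].
apply/subset_leq_card/subsetP=> _ /setUP[]/imsetP[x xA ->].
  case/setIdP: xA => xA /eqP rx; apply/imsetP; exists (Inl x).
    by rewrite inE mem_inl -in_setC.
  by rewrite /= rx.
apply/imsetP; exists (inr (exist _ x (AL x xA), h0)); first by rewrite inE mem_inr.
by rewrite /= xA.
Qed.

(** * Cutting at a vertex of [L] and inside its copy of [H] *)

Section Fibre.
Variables (v : TG) (vL : v \in L).
Hypothesis connGv : connected_on eG (~: [set v]).
Let sv : {x : TG | x \in L} := exist _ v vL.

Definition fibre_cut (B : {set TH}) : {set V} :=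
  Inl v |: [set inr (sv, h) | h in B].

Definition fibre_label (B : {set TH}) (z : V) : option TH :=
  if z is inr (w, h) then if w == sv then Some (comp_root eH B h) else None
  else None.

Lemma mem_fibre_cut_inl (B : {set TH}) x : (Inl x \in fibre_cut B) = (x == v).
Proof.
rewrite !inE; have -> : (Inl x \in [set inr (sv, h) | h in B]) = false.
  by apply/imsetP=> -[].
by rewrite orbF.
Qed.

Lemma mem_fibre_cut_inr (B : {set TH}) w h :
  ((inr (w, h) : V) \in fibre_cut B) = (w == sv) && (h \in B).
Proof.
rewrite !inE /=; apply/imsetP/andP => [[h' h'B [-> ->]]|[/eqP-> hB]]; first by [].
by exists h.
Qed.

Lemma fibre_label_edge (B : {set TH}) x y :
  x \notin fibre_cut B -> y \notin fibre_cut B -> C x y ->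
  fibre_label B x = fibre_label B y.
Proof.
case: x => [x|[w h]]; case: y => [y|[w' h']];
  rewrite ?mem_fibre_cut_inl ?mem_fibre_cut_inr /= ?negb_and.
- by [].
- move=> ne_xv _ /eqP eq_x; case: eqP => // eq_w.
  by rewrite eq_x eq_w eqxx in ne_xv.
- move=> _ ne_yv /eqP eq_y; case: eqP => // eq_w.
  by rewrite -eq_y eq_w eqxx in ne_yv.
- move=> wh wh' /andP[/eqP eq_w ehh']; rewrite -eq_w in wh' *.
  by case: eqP wh wh' => //= _ hB hB'; rewrite (comp_root_edge symH hB hB' ehh').
Qed.

Lemma exists_other : exists2 u, u != v & eG v u.
Proof.
have /card_gt1P[x [y [_ _ ne_xy]]] := TG_gt1.
have [z ne_vz] : exists z, v != z.
  by have [<-|] := eqVneq x v; [exists y|exists x; rewrite eq_sym].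
have [u _ evu] := exists_neighbour connG (in_setT v) (in_setT z) ne_vz.
by exists u => //; apply: contraTneq evu => ->; rewrite irrG.
Qed.

Lemma fibre_separating (B : {set TH}) :
  separating eH B -> separating C (fibre_cut B).
Proof.
move=> sepB; have [u ne_uv evu] := exists_other.
(* [B] is not all of [H], since a vertex of a separating set has neighbours outside it. *)
have [h0 h0B] : exists h0, h0 \notin B.
  have [->|[h hB]] := set_0Vmem B.
    by have /card_gt0P[h0 _] := TH_gt0; exists h0; rewrite inE.
  by have /existsP[h1 /existsP[h2 /and3P[? _ _]]] := implyP (forallP sepB h) hB; exists h1.
apply/forall_inP=> z /setU1P[->|/imsetP[h hB ->]] {z}.
  apply/existsP; exists (inr (sv, h0)); apply/existsP; exists (Inl u).
  rewrite mem_fibre_cut_inl mem_fibre_cut_inr (negPf h0B) andbF ne_uv /= evu eqxx /=.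
  by apply: (not_connect_label (@fibre_label_edge B)); rewrite /= eqxx.
have /existsP[h1 /existsP[h2 /and5P[h1B h2B e1 e2]]] := implyP (forallP sepB h) hB.
rewrite -comp_rootP // => ne_root.
apply/existsP; exists (inr (sv, h1)); apply/existsP; exists (inr (sv, h2)).
rewrite !mem_fibre_cut_inr (negPf h1B) (negPf h2B) andbF /= eqxx e1 e2 /=.
by apply: (not_connect_label (@fibre_label_edge B)); rewrite /= eqxx.
Qed.

(** The vertices labelled [None] are connected to each other: [G] without [v] is connected, and
    every other copy of [H] hangs on one of its vertices. *)
Lemma fibre_label_connect (B : {set TH}) x y :
  x \notin fibre_cut B -> y \notin fibre_cut B ->
  fibre_label B x = fibre_label B y ->
  connect (restrict_rel C (~: fibre_cut B)) x y.
Proof.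
have to_inl z : z \notin fibre_cut B -> fibre_label B z = None ->
    exists2 g, g != v & connect (restrict_rel C (~: fibre_cut B)) z (Inl g).
  case: z => [g|[w h]] zB /=.
    by exists g; rewrite ?connect0 // -(mem_fibre_cut_inl B).
  case: eqP => // /eqP ne_w _; have ne_wv : val w != v by [].
  exists (val w) => //; rewrite connect1 //; apply/and3P; split=> /=; last by [].
    by rewrite in_setC.
  by rewrite in_setC mem_fibre_cut_inl.
move=> xB yB eq_lab; case def_lab: (fibre_label B x) => [r|]; last first.
  have [g gv xg] := to_inl x xB def_lab.
  have [g' g'v yg'] := to_inl y yB (etrans (esym eq_lab) def_lab).
  apply: connect_trans xg _; rewrite (restrict_connect_sym corona_sym) in yg'.
  apply: connect_trans _ yg'.
  apply: connect_inl (connGv _ _); rewrite ?inE // => z.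
  by rewrite !in_setC mem_fibre_cut_inl in_set1.
have fibre z : fibre_label B z = Some r -> exists2 h, z = inr (sv, h) & comp_root eH B h = r.
  by case: z => [|[w h]] //=; case: eqP => // -> [<-]; exists h.
have [h def_x hr] := fibre x def_lab.
have [h' def_y h'r] := fibre y (etrans (esym eq_lab) def_lab).
have chh' : connect (restrict_rel eH (~: B)) h h' by rewrite -comp_rootP // hr h'r.
rewrite def_x def_y; move: chh'; apply: (connect_homo (f := fun h => inr (sv, h) : V)).
move=> h1 h2 /and3P[h1B h2B e12]; rewrite connect1 //; apply/and3P.
by rewrite !in_setC !mem_fibre_cut_inr /= !eqxx e12 /= -!in_setC.
Qed.

Lemma omega_fibre_cut (B : {set TH}) :
  omega C (fibre_cut B) = (omega eH B).+1.
Proof.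
have [u ne_uv _] := exists_other.
suff imE : [set fibre_label B z | z in ~: fibre_cut B] =
    None |: [set Some h | h in comp_reps eH B] :> {set option TH}.
  have -> : omega C (fibre_cut B) = #|[set fibre_label B z | z in ~: fibre_cut B]|.
    apply/eqP; rewrite eqn_leq (leq_label_omega corona_sym (@fibre_label_edge B)).
    by rewrite (leq_omega_label corona_sym (@fibre_label_connect B)).
  rewrite imE cardsU1 card_imset; last by move=> x y [].
  rewrite omega_reps // (_ : None \in _ = false) //.
  by apply/imsetP=> -[].
apply/setP=> o; apply/imsetP/setU1P => [[z]|[->|/imsetP[h]]].
- rewrite in_setC => zB ->; case: z zB => [|[w h]] /=; first by left.
  rewrite mem_fibre_cut_inr; case: eqP => /= [_ hB|]; last by left.
  by right; apply/imset_f/comp_root_reps.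
- by exists (Inl u); rewrite // in_setC mem_fibre_cut_inl.
- case/setIdP=> hB /eqP hr ->; exists (inr (sv, h)); last by rewrite /= eqxx hr.
  by rewrite in_setC mem_fibre_cut_inr eqxx -in_setC.
Qed.

Lemma card_fibre_cut (B : {set TH}) : #|fibre_cut B| = #|B|.+1.
Proof.
rewrite cardsU1 card_imset; last by move=> h h' [].
by rewrite (_ : _ \in _ = false) //; apply/imsetP=> -[].
Qed.

End Fibre.
End Corona.

(** * Unmixed corona products *)

Theorem theorem3p3 (k : fieldType) (TG TH : finType) (eG : rel TG) (eH : rel TH)
  (L : {set TG}) :
  simple_graph eG -> connected_graph eG -> (1 < #|TG|)%N ->
  simple_graph eH -> connected_graph eH -> (0 < #|TH|)%N ->
  L != set0 -> L \proper [set: TG] ->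
  unmixed (binomial_edge_ideal k (corona_rel eG eH L)) ->
  ((forall v, v \in L -> ~ cut_vertex eG v) /\
   (forall L0 : {set TG}, L0 \subset L ->
      cutset (corona_rel eG eH L) [set inl x | x in L0] /\
      connected_on eG (~: L0)) /\
   connected_on eG (~: L)) /\
  unmixed (binomial_edge_ideal k eH).
Proof.
move=> [symG irrG] connG TG_gt1 [symH irrH] connH TH_gt0 L_neq0 L_proper.
have symC := corona_sym (L := L) symG symH; have irrC := corona_irr (L := L) irrG irrH.
move=> /(unmixedP _ symC irrC) unmC.
have nonempty (T : finType) : (0 < #|T|)%N -> ~: (set0 : {set T}) != set0.
  by case/card_gt0P=> x _; apply/set0Pn; exists x; rewrite !inE.
have TG_gt0 : (0 < #|TG|)%N by apply: ltnW.
have omegaC0 : omega (corona_rel eG eH L) set0 = 1%N.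
  apply: (connected_omega1 symC); first exact: corona_connected.
  by apply: nonempty; rewrite card_sum addn_gt0 TG_gt0.
(* Connectedness of [G] without the smaller sets [A :\ v] makes [A] separating in the corona
   product. Unmixedness then gives [#|A| + 1] components, of which the copies over [A] leave at most
   one for [G \ A]. *)
have main n (A : {set TG}) : (#|A| < n)%N -> A \subset L ->
    separating (corona_rel eG eH L) [set inl x | x in A] /\ connected_on eG (~: A).
  elim: n A => // n IHn A le_A AL.
  have sepA : separating (corona_rel eG eH L) [set inl x | x in A].
    apply: corona_separating => // v vA; apply: (IHn (A :\ v) _ _).2.
      by move: le_A; rewrite (cardsD1 v A) vA.
    exact: subset_trans (subsetDl _ _) AL.
  split=> //; apply: omega_le1_connected => //.
  have := leq_corona_omega (eH := eH) symG symH TH_gt0 AL.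
  rewrite (unmC _ sepA) omegaC0 card_imset; last by move=> x y [].
  by rewrite addnC leq_add2l.
have conn (A : {set TG}) (AL : A \subset L) : connected_on eG (~: A).
  exact: (main _ A (leqnn _) AL).2.
split; last first.
  apply/(unmixedP _ symH irrH) => B sepB.
  have [v vL] := set0Pn _ L_neq0.
  have connGv : connected_on eG (~: [set v]) by apply: conn; rewrite sub1set.
  (* From [B] to its fibre cut both the cardinal and the number of components grow by one, so the
     equality descends to [H]. *)
  have := unmC _ (fibre_separating irrG symH connG TG_gt1 TH_gt0 vL sepB).
  rewrite omega_fibre_cut // card_fibre_cut omegaC0 addSn => -[->].
  by rewrite (connected_omega1 symH) ?nonempty // setC0.
split; [|split]; last exact: conn.
- move=> v vL; rewrite /cut_vertex; apply/negP; rewrite -leqNgt.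
  rewrite [X in (_ <= X)%N](connected_omega1 symG) ?nonempty ?setC0 //.
  by apply: connected_omega_le1 => //; apply: conn; rewrite sub1set.
- move=> A AL; split; last exact: conn.
  by apply: separating_cutset => //; apply: (main _ A (leqnn _) AL).1.
Qed.
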